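(* Let $H_1(D)$ and $H_2(D)$ be check matrices, of dimensions $(n-k_1)\times n$ and $(n-k_2)\times n$, corresponding to noncatastrophic, delay-free encoders for classical binary convolutional codes, with Smith decompositions $H_i(D)=A_i(D)[\,I\;\;0\,]B_i(D)$, let $B_{ia}(D)$ be the first $n-k_i$ rows of $B_i(D)$, and let $E(D)=B_{1a}(D)B_{2a}^T(D^{-1})$, of rank $c$. Suppose that the Smith form of $E(D)$ is not of the form $$\begin{bmatrix}\Gamma(D)&0\\0&0\end{bmatrix}$$ with $\Gamma(D)$ a $c\times c$ diagonal matrix whose entries are all powers of $D$. Then the entanglement-assisted quantum convolutional code with quantum check matrix $$\left[\left.\begin{array}{c}H_1(D)\\0\end{array}\right|\begin{array}{c}0\\H_2(D)\end{array}\right]$$ and $c$ ebits and $k_1+k_2-n+c$ information qubits per frame has an encoding circuit with both infinite-depth and finite-depth operations, and a decoding circuit with finite-depth operations only.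
   Context: Classical check matrices. $H_i(D)$ is a matrix over $\mathbb{F}_2[D]$; ''corresponding to a noncatastrophic, delay-free encoder'' means that all invariant factors of $H_i(D)$ over $\mathbb{F}_2[D]$ are equal to $1$, so that $H_i(D)=A_i(D)[\,I\;\;0\,]B_i(D)$ with $A_i(D)$ ($(n-k_i)\times(n-k_i)$) and $B_i(D)$ ($n\times n$) invertible over $\mathbb{F}_2[D]$. The Smith form of $E(D)$ is taken over the Laurent polynomial ring $\mathbb{F}_2[D,D^{-1}]$ (so invariant factors are defined up to powers of $D$). Ranks are over $\mathbb{F}_2(D)$; the rank of $E(D)$ equals that of $H_1(D)H_2^T(D^{-1})$. Binary polynomial picture. A family of Pauli sequences on a stream of qubits divided into frames of $m$ qubits, taken up to phase and together with all frame shifts, is described by a matrix $[Z(D)\,|\,X(D)]$ with $m$ columns on each side, one row per generator, entries in $\mathbb{F}_2[D,D^{-1}]$ for finite-weight generators and in $\mathbb{F}_2(D)$ in general. Multiplication of a row by $D^l$ is a shift by $l$ frames. A quantum check matrix is such a matrix whose rows need not commute. Row operations: interchange two rows, add a polynomial multiple of one row to another, multiply a row by a power of $D$ or by a nonzero polynomial (and inverses of these); two matrices are row equivalent if they differ by left multiplication by an invertible matrix over $\mathbb{F}_2(D)$. Finite-depth operations (column operations), used in every frame: CNOT from qubit $i$ to qubit $j\ne i$ delayed by $k\in\mathbb{Z}$ frames (in $X$: add $D^k\cdot$column $i$ to column $j$; in $Z$: add $D^{-k}\cdot$column $j$ to column $i$); Hadamard on qubit $i$ (swap column $i$ of $Z$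 with column $i$ of $X$); SWAP of two qubits; delay/advance of qubit $i$ (multiply column $i$ of both $Z$ and $X$ by $D^l$, $l\in\mathbb{Z}$); and compositions. Infinite-depth operations: for a nonzero $f(D)\in\mathbb{F}_2[D,D^{-1}]$ and a qubit $i$, multiply column $i$ of $X$ by $1/f(D)$ and column $i$ of $Z$ by $f(D^{-1})$. Entanglement-assisted quantum convolutional codes. In each frame the receiver Bob holds $c$ qubits and the sender Alice holds $n$ qubits. With $k=k_1+k_2-n+c$, the unencoded stream has per frame $c$ ebits (Bell states $(|00\rangle+|11\rangle)/\sqrt2$ between Bob's $c$ qubits and $c$ of Alice's), $n-k-c$ ancilla qubits in state $|0\rangle$ and $k$ information qubits, the latter two types held by Alice. Its stabilizer matrix has, for each ebit, a row with $Z$-entries $1$ on the two qubits of the ebit and a row with $X$-entries $1$ on these two qubits, and, for each ancilla, a row with single $Z$-entry $1$ on it (all other entries $0$). The information-qubit matrix has, for each information qubit, one row that is a single $Z$-entry $1$ and one row that is a single $X$-entry $1$ on that qubit. An encoding circuit is a finite sequence of operations on Alice's $n$ qubits (acting on both matrices) such that the restriction of the resulting stabilizer matrix to Alice's columns is row equivalent to the quantum check matrix of the code. A decoding circuit is a finite sequence of operations on all $n+c$ qubits, applied to the encoded stream, after which the information-qubit matrix, modulo adding multiples of rows of the resulting stabilizer matrix, again consists of the operators $Z$ and $X$ (possibly shifted by powers of $D$) on $k$ individual qubits of each frame. *)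

(* Defs.v *)
From HB Require Import structures.
From mathcomp Require Import all_boot all_order all_algebra.

Set Implicit Arguments.
Unset Strict Implicit.
Unset Printing Implicit Defensive.

Import GRing.Theory.
Local Open Scope ring_scope.

Definition F2D : comUnitRingType := {poly 'F_2}.
Definition F2rat : fieldType := {fraction {poly 'F_2}}.

Definition atD (p : {poly 'F_2}) : F2rat := FracField.tofrac p.
Definition D : F2rat := atD 'X.

(* p(D^-1); for polynomials p this is an evaluation, so no extension of
   D |-> D^-1 to all of F_2(D) is needed. *)
Definition atDinv (p : {poly 'F_2}) : F2rat :=
  (map_poly (fun a : 'F_2 => atD a%:P) p).[D^-1].

(* Membership in the Laurent polynomial ring F_2[D, D^-1]. *)
Definition laurent (x : F2rat) : Prop :=
  exists (p : {poly 'F_2}) (l : int), x = D ^ l * atD p.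

Definition laurent_mx m n (M : 'M[F2rat]_(m, n)) : Prop :=
  forall i j, laurent (M i j).

Definition laurent_unitmx m (U : 'M[F2rat]_m) : Prop :=
  [/\ laurent_mx U, U \in unitmx & laurent_mx (invmx U)].

Definition laurent_dvd (x y : F2rat) : Prop :=
  exists2 z, laurent z & y = z * x.

Definition smith_form m n (E S : 'M[F2rat]_(m, n)) : Prop :=
  [/\ laurent_mx S,
      forall (i : 'I_m) (j : 'I_n), i != j :> nat -> S i j = 0,
      forall (i i' : 'I_m) (j j' : 'I_n), i = j :> nat -> i' = j' :> nat ->
        (i <= i')%N -> laurent_dvd (S i j) (S i' j')
    & exists (U : 'M[F2rat]_m) (V : 'M[F2rat]_n),
        [/\ laurent_unitmx U, laurent_unitmx V & E = U *m S *m V]].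

(* S = [Gamma, 0; 0, 0] with Gamma = diag(D^(l 0), ..., D^(l (c-1))). *)
Definition monomial_block c m n (S : 'M[F2rat]_(m, n)) : Prop :=
  exists l : nat -> int,
    S = \matrix_(i, j) (if (i == j :> nat) && (i < c)%N then D ^ l i else 0).

(* Here [pid_mx (n - k)] is the (n - k) x n matrix [I 0]. *)
Definition smith_decomposition n k (H : 'M[F2D]_(n - k, n))
    (A : 'M[F2D]_(n - k)) (B : 'M[F2D]_n) : Prop :=
  [/\ A \in unitmx, B \in unitmx & H = A *m pid_mx (n - k) *m B].

Definition first_rows n k (B : 'M[F2D]_n) : 'M[F2D]_(n - k, n) :=
  rowsub (widen_ord (leq_subr k n)) B.

Definition Emx n k1 k2 (B1 B2 : 'M[F2D]_n) : 'M[F2rat]_(n - k1, n - k2) :=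
  map_mx atD (first_rows k1 B1) *m (map_mx atDinv (first_rows k2 B2))^T.

(* The matrix [Z | X] on N qubits per frame is an element of 'M_(r, N + N):
   qubit i owns the columns [lshift N i] and [rshift N i]. *)

Definition check_matrix n r1 r2 (H1 : 'M[F2D]_(r1, n)) (H2 : 'M[F2D]_(r2, n)) :
    'M[F2rat]_(r1 + r2, n + n) :=
  block_mx (map_mx atD H1) 0 0 (map_mx atD H2).

(* U V = 1 and V U = 1 force r = s; U is the invertible matrix over F_2(D). *)
Definition row_equivalent r s q (M : 'M[F2rat]_(r, q)) (M' : 'M[F2rat]_(s, q)) :
    Prop :=
  exists (U : 'M[F2rat]_(s, r)) (V : 'M[F2rat]_(r, s)),
    [/\ U *m V = 1%:M, V *m U = 1%:M & M' = U *m M].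

(* [InfDepth i l] is the infinite-depth operation for f(D) = D^l p(D), the
   general nonzero Laurent polynomial. *)
Inductive operation (N : nat) : Type :=
  | CNOT (i j : 'I_N) (k : int) of i != j
  | Hadamard (i : 'I_N)
  | Swap (i j : 'I_N)
  | Delay (i : 'I_N) (l : int)
  | InfDepth (i : 'I_N) (l : int) (p : {poly 'F_2}) of p != 0.

Definition finite_depth N (o : operation N) : bool :=
  if o is InfDepth _ _ _ _ then false else true.

Definition acts_within N (A : pred 'I_N) (o : operation N) : bool :=
  match o with
  | CNOT i j _ _ | Swap i j => A i && A j
  | Hadamard i | Delay i _ | InfDepth i _ _ _ => A i
  end.

(* M *m addcol_mx i j a is M with a times column i added to column j, and
   M *m scalecol_mx i a is M with column i multiplied by a. *)
Definition addcol_mx N (i j : 'I_N) (a : F2rat) : 'M[F2rat]_N :=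
  1%:M + a *: delta_mx i j.

Definition scalecol_mx N (i : 'I_N) (a : F2rat) : 'M[F2rat]_N :=
  diag_mx (\row_j (if j == i then a else 1)).

Definition apply_op N r (W : 'M[F2rat]_(r, N + N)) (o : operation N) :
    'M[F2rat]_(r, N + N) :=
  let Z := lsubmx W in
  let X := rsubmx W in
  match o with
  | CNOT i j k _ =>
      row_mx (Z *m addcol_mx j i (D ^ (- k))) (X *m addcol_mx i j (D ^ k))
  | Hadamard i => xcol (lshift N i) (rshift N i) W
  | Swap i j => row_mx (xcol i j Z) (xcol i j X)
  | Delay i l => row_mx (Z *m scalecol_mx i (D ^ l)) (X *m scalecol_mx i (D ^ l))
  | InfDepth i l p _ =>
      row_mx (Z *m scalecol_mx i (D ^ (- l) * atDinv p))
             (X *m scalecol_mx i (D ^ l * atD p)^-1)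
  end.

(* The head of the list is the operation performed first. *)
Definition circuit N := seq (operation N).

Definition run N r (C : circuit N) (W : 'M[F2rat]_(r, N + N)) :
    'M[F2rat]_(r, N + N) :=
  foldl (@apply_op N r) W C.

(* A frame has c + n qubits: Bob's are [lshift n i], Alice's [rshift c j].
   In the unencoded stream Alice's qubits are, in this order, the c halves of
   the ebits, the n - k - c ancillas and the k information qubits. *)
Definition alice c n : pred 'I_(c + n) := fun q => (c <= q)%N.

Definition alice_columns c n r (W : 'M[F2rat]_(r, (c + n) + (c + n))) :
    'M[F2rat]_(r, n + n) :=
  row_mx (rsubmx (lsubmx W)) (rsubmx (rsubmx W)).

(* Row i has a single entry 1, on qubit s + i. *)
Definition ones_from r N (s : nat) : 'M[F2rat]_(r, N) :=
  \matrix_(i, j) ((j : nat) == s + i)%N%:R.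

Definition ebit_rows c n : 'M[F2rat]_(c, c + n) :=
  ones_from c (c + n) 0 + ones_from c (c + n) c.

Definition unencoded_stabilizer c n k :
    'M[F2rat]_(c + c + (n - k - c), (c + n) + (c + n)) :=
  row_mx (col_mx (col_mx (ebit_rows c n) 0)
                 (ones_from (n - k - c) (c + n) (c + c)))
         (col_mx (col_mx 0 (ebit_rows c n)) 0).

Definition unencoded_information c n k :
    'M[F2rat]_(k + k, (c + n) + (c + n)) :=
  let P := ones_from k (c + n) (c + c + (n - k - c)) in block_mx P 0 0 P.

Definition encoding_circuit c n k r (Q : 'M[F2rat]_(r, n + n))
    (enc : circuit (c + n)) : Prop :=
  all (acts_within (@alice c n)) enc /\
  row_equivalent (alice_columns (run enc (unencoded_stabilizer c n k))) Q.

(* P(D): row i is the single entry D^(l i) on qubit q i. *)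
Definition shifted_qubits k N (q : 'I_k -> 'I_N) (l : 'I_k -> int) :
    'M[F2rat]_(k, N) :=
  \matrix_(i, j) (if j == q i then D ^ l i else 0).

Definition decoding_circuit c n k (enc dec : circuit (c + n)) : Prop :=
  let S := run dec (run enc (unencoded_stabilizer c n k)) in
  let L := run dec (run enc (unencoded_information c n k)) in
  exists (q : 'I_k -> 'I_(c + n)) (l : 'I_k -> int)
         (M : 'M[F2rat]_(k + k, c + c + (n - k - c))),
    [/\ injective q, laurent_mx M
      & L + M *m S = block_mx (shifted_qubits q l) 0 0 (shifted_qubits q l)].

(* Main.v *)
(* Write s for the conjugation D |-> 1/D, let Z and X be the row
   spaces of H1(D) and H2(D) over F_2(D), and let K be the space of vectors that
   are s-orthogonal to X, so that dim Z - dim (Z :&: K) = rank E(D) = c.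
   Since row operations over F_2(D) are free, a basis adapted to the flag
   Z :&: K < K < K + Z can be brought to triangular shape by polynomial column
   operations, that is by CNOTs and SWAPs (no Smith form of E(D) is needed).
   Afterwards Z is spanned by ancilla vectors and by c rows [I | F] on the
   ebits and the information qubits, with F over F_2(D), while X is spanned by
   unit vectors on ebits and ancillas.  Writing F = G / d with G and d
   polynomial (in 1/D), the rows [d I | G] are produced from the ebits by the
   finite-depth CNOTs with coefficients G and the infinite-depth operation d on
   each ebit.

   To decode, one undoes only the column reduction.  Up to Laurent polynomial
   multiples of the ebit rows, the X-operators of the information qubits then
   differ from unit vectors by a finite-depth term s(G) on Bob's qubits, which
   CNOTs from the information qubits to Bob's qubits remove; the infinite-depth
   operations need not be inverted. *)
Require Import Defs.
From HB Require Import structures.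
From mathcomp Require Import all_boot all_order perm all_algebra.
From mathcomp Require Import zify.

Set Implicit Arguments.
Unset Strict Implicit.
Unset Printing Implicit Defensive.

Import GRing.Theory.
Local Open Scope ring_scope.

(** * The automorphism D |-> 1/D of F_2(D) *)

HB.instance Definition _ := GRing.RMorphism.copy atD (@FracField.tofrac {poly 'F_2}).

Definition atD_const (a : 'F_2) : F2rat := atD a%:P.
HB.instance Definition _ := GRing.RMorphism.copy atD_const (atD \o polyC).

Lemma atDinvE p : atDinv p = (map_poly atD_const p).[D^-1].
Proof. by []. Qed.

Lemma atDinv_is_zmod_morphism : zmod_morphism atDinv.
Proof. by move=> p q; rewrite !atDinvE rmorphB hornerD hornerN. Qed.

Lemma atDinv_is_monoid_morphism : monoid_morphism atDinv.
Proof.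
split=> [|p q]; rewrite !atDinvE; first by rewrite rmorph1 hornerC.
by rewrite rmorphM hornerM.
Qed.

HB.instance Definition _ :=
  GRing.isZmodMorphism.Build {poly 'F_2} F2rat atDinv atDinv_is_zmod_morphism.
HB.instance Definition _ :=
  GRing.isMonoidMorphism.Build {poly 'F_2} F2rat atDinv atDinv_is_monoid_morphism.

Lemma atD_eq0 p : (atD p == 0) = (p == 0).
Proof. exact: tofrac_eq0. Qed.

Lemma D_neq0 : D != 0.
Proof. by rewrite atD_eq0 polyX_eq0. Qed.

Lemma atDE p : atD p = \sum_(i < size p) atD_const p`_i * D ^+ i.
Proof.
rewrite -[p in LHS]coefK poly_def rmorph_sum /=; apply: eq_bigr => i _.
by rewrite -mul_polyC rmorphM rmorphXn.
Qed.

Lemma atDinv_sumE p : atDinv p = \sum_(i < size p) atD_const p`_i * D ^- i.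
Proof.
rewrite atDinvE horner_coef size_map_poly; apply: eq_bigr => i _.
by rewrite coef_map exprVn.
Qed.

(* Multiplying by [D ^ deg p] turns [p(D^-1)] into the reciprocal polynomial of
   [p], whose constant term is the leading coefficient of [p]. *)
Lemma atDinv_eq0 p : (atDinv p == 0) = (p == 0).
Proof.
apply/eqP/eqP => [p0|->]; last exact: rmorph0.
apply/eqP; rewrite -size_poly_eq0; case Es: (size p) => [//|s].
pose q := \sum_(i < s.+1) p`_i *: 'X^(s - i).
have: atD q = 0.
  have <- : D ^+ s * atDinv p = 0 by rewrite p0 mulr0.
  rewrite rmorph_sum /= atDinv_sumE Es mulr_sumr.
  apply: eq_bigr => i _; rewrite -mul_polyC rmorphM rmorphXn mulrCA.
  by rewrite -[in D ^+ s](@subnK i s) -1?ltnS // exprD mulfK ?expf_neq0 ?D_neq0.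
move/eqP; rewrite atD_eq0 => /eqP q0.
have := congr1 (horner^~ 0) q0; rewrite horner0 horner_sum big_ord_recr /=.
rewrite hornerZ hornerXn subnn expr0 mulr1 big1 ?add0r => [ps|i _]; last first.
  by rewrite hornerZ hornerXn expr0n subn_eq0 leqNgt ltn_ord mulr0.
have := lead_coef_eq0 p; rewrite lead_coefE Es ps eqxx -size_poly_eq0 Es.
by [].
Qed.

(** Read off the chosen representative of the class of [x], which need not be a reduced fraction;
    [conjD_frac] shows that the choice does not affect [conjD]. *)
Definition numer (x : F2rat) : {poly 'F_2} := (frac (repr x)).1.
Definition denom (x : F2rat) : {poly 'F_2} := (frac (repr x)).2.

Lemma denom_neq0 x : denom x != 0.
Proof. exact: denom_ratioP. Qed.

Lemma numer_denom x : x = atD (numer x) / atD (denom x).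
Proof.
apply: canRL (mulfK _) _; first by rewrite atD_eq0 denom_neq0.
rewrite /numer /denom; have := reprK x; move: (repr x) => y <-.
(* The product is exposed as the class of a product of ratios, so the equality becomes a
   cross-multiplication of polynomials. *)
rewrite -[LHS]/(FracField.mul _ _) /atD !piE; apply/eqmodP.
rewrite /= FracField.equivfE !numden_Ratio ?(oner_eq0, mulf_neq0, denom_ratioP) //.
by rewrite !mulr1 mulrC.
Qed.

Definition conjD (x : F2rat) : F2rat := atDinv (numer x) / atDinv (denom x).

(** Equal fractions have equal cross products in F_2[D]; [atDinv] preserves this identity and, being
    injective, keeps the denominators nonzero. *)
Lemma conjD_frac p q : q != 0 -> conjD (atD p / atD q) = atDinv p / atDinv q.
Proof.
move=> q0; rewrite /conjD; have dx := denom_neq0 (atD p / atD q).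
have /eqP := numer_denom (atD p / atD q); move: (denom _) (numer _) dx => d n d0.
rewrite eqr_div ?atD_eq0 // -!rmorphM /=.
rewrite -subr_eq0 -rmorphB atD_eq0 subr_eq0 => /eqP e.
by apply/eqP; rewrite eqr_div ?atDinv_eq0 // -!rmorphM /= e.
Qed.

Lemma conjD_atD p : conjD (atD p) = atDinv p.
Proof.
by rewrite -[atD p]divr1 -(rmorph1 atD) conjD_frac ?oner_eq0 // rmorph1 divr1.
Qed.

Lemma conjD_is_zmod_morphism : zmod_morphism conjD.
Proof.
move=> x y; rewrite {1}(numer_denom x) {1}(numer_denom y). rewrite -mulNr -rmorphN.
have [dx dy] := (denom_neq0 x, denom_neq0 y).
rewrite addf_div ?atD_eq0 // -!rmorphM -rmorphD conjD_frac ?mulf_neq0 //.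
by rewrite /conjD -mulNr addf_div ?atDinv_eq0 // rmorphD !rmorphM /= rmorphN.
Qed.

Lemma conjD_is_monoid_morphism : monoid_morphism conjD.
Proof.
split=> [|x y]; first by rewrite -(rmorph1 atD) conjD_atD !rmorph1.
rewrite {1}(numer_denom x) {1}(numer_denom y) mulf_div -!rmorphM.
by rewrite conjD_frac ?mulf_neq0 ?denom_neq0 // /conjD mulf_div !rmorphM.
Qed.

HB.instance Definition _ :=
  GRing.isZmodMorphism.Build F2rat F2rat conjD conjD_is_zmod_morphism.
HB.instance Definition _ :=
  GRing.isMonoidMorphism.Build F2rat F2rat conjD conjD_is_monoid_morphism.

Lemma conjD_D : conjD D = D^-1.
Proof. by rewrite conjD_atD atDinvE map_polyX hornerX. Qed.

Lemma conjD_Dexp l : conjD (D ^ l) = D ^ (- l).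
Proof. by rewrite rmorphXz ?unitfE ?D_neq0 //= conjD_D exprz_inv. Qed.

Lemma conjD_atDinv p : conjD (atDinv p) = atD p.
Proof.
rewrite atDinv_sumE atDE rmorph_sum; apply: eq_bigr => i _.
rewrite rmorphM /= fmorphV rmorphXn /= conjD_D exprVn invrK; congr (_ * _).
by rewrite conjD_atD atDinvE map_polyC hornerC.
Qed.

Lemma conjDK : involutive conjD.
Proof.
move=> x; rewrite [x in RHS]numer_denom {2}/conjD.
by rewrite rmorphM fmorphV /= !conjD_atDinv.
Qed.

Lemma F2rat_add_self (x : F2rat) : x + x = 0.
Proof.
rewrite -mulr2n -mulr_natl -(rmorph_nat atD) -polyC_natr.
by rewrite (_ : 2%:R = 0 :> 'F_2) ?rmorph0 ?mul0r //; apply: val_inj.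
Qed.

(** * CNOT circuits *)

Lemma mx_add_self m n (A : 'M[F2rat]_(m, n)) : A + A = 0.
Proof. by apply/matrixP=> i j; rewrite !mxE F2rat_add_self. Qed.

Lemma F2_poly_add_self (p : {poly 'F_2}) : p + p = 0.
Proof. by apply/eqP; rewrite -atD_eq0 rmorphD /= F2rat_add_self. Qed.

(** Operations act on columns only, hence commute with row operations; a circuit thus becomes right
    multiplication by the fixed matrix [run C 1%:M]. *)
Lemma apply_op_mulmx N r s (U : 'M[F2rat]_(s, r)) (W : 'M_(r, N + N)) o :
  apply_op (U *m W) o = U *m apply_op W o.
Proof.
case: o => [i j k ij|i|i j|i l|i l p p0] /=.
- by rewrite mul_mx_row !mulmxA !(mulmx_lsub, mulmx_rsub).
- by rewrite !xcolE mulmxA.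
- by rewrite !xcolE mul_mx_row !mulmxA !(mulmx_lsub, mulmx_rsub).
- by rewrite mul_mx_row !mulmxA !(mulmx_lsub, mulmx_rsub).
- by rewrite mul_mx_row !mulmxA !(mulmx_lsub, mulmx_rsub).
Qed.

Lemma run_mulmx N r s (U : 'M[F2rat]_(s, r)) (W : 'M_(r, N + N)) C :
  run C (U *m W) = U *m run C W.
Proof. by elim: C W => //= o C IH W; rewrite apply_op_mulmx IH. Qed.

Lemma run_mulmxr N r (W : 'M[F2rat]_(r, N + N)) C :
  run C W = W *m run C 1%:M.
Proof. by rewrite -run_mulmx mulmx1. Qed.

Lemma run_cat N r (W : 'M[F2rat]_(r, N + N)) C1 C2 :
  run (C1 ++ C2) W = run C2 (run C1 W).
Proof. exact: foldl_cat. Qed.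

(** In characteristic 2 these gates are their own inverses, so a circuit made of them is inverted by
    reversing the list. *)
Definition involutive_op N (o : operation N) : bool :=
  match o with Delay _ _ | InfDepth _ _ _ _ => false | _ => true end.

Lemma involutive_finite_depth N (o : operation N) :
  involutive_op o -> finite_depth o.
Proof. by case: o. Qed.

Lemma addcol_mxK N r (Z : 'M[F2rat]_(r, N)) i j a :
  i != j -> Z *m addcol_mx i j a *m addcol_mx i j a = Z.
Proof.
move=> ij; rewrite -mulmxA -[RHS]mulmx1; congr (_ *m _).
rewrite /addcol_mx mulmxDl mul1mx mulmxDr mulmx1 -scalemxAl -scalemxAr.
by rewrite mul_delta_mx_0 1?eq_sym // !scaler0 addr0 -addrA mx_add_self addr0.
Qed.

Lemma xcolK N r (Z : 'M[F2rat]_(r, N)) i j : xcol i j (xcol i j Z) = Z.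
Proof. by apply/matrixP=> u v; rewrite !mxE tpermK. Qed.

Lemma apply_op_involutive N r (W : 'M[F2rat]_(r, N + N)) o :
  involutive_op o -> apply_op (apply_op W o) o = W.
Proof.
case: o => //= [i j k ij|i|i j] _.
- have ji : j != i by rewrite eq_sym.
  by rewrite !row_mxKl !row_mxKr !addcol_mxK // hsubmxK.
- exact: xcolK.
- by rewrite !row_mxKl !row_mxKr !xcolK hsubmxK.
Qed.

Lemma run_revK N r (W : 'M[F2rat]_(r, N + N)) C :
  all (@involutive_op N) C -> run C (run (rev C) W) = W.
Proof.
elim: C W => //= o C IH W /andP[ho hC].
by rewrite rev_cons -cats1 run_cat /= apply_op_involutive ?IH.
Qed.

Lemma run_Krev N r (W : 'M[F2rat]_(r, N + N)) C :
  all (@involutive_op N) C -> run (rev C) (run C W) = W.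
Proof. by move=> hC; rewrite -{2}[C]revK run_revK // all_rev. Qed.

(* The third condition is the invariance of the symplectic form, the last one
   expresses that the circuit acts on the qubits in [P] only. *)
Definition cnot_circuit N (P : pred 'I_N) (V' V : 'M[F2rat]_N) : Prop :=
  exists C : circuit N,
    [/\ all (@involutive_op N) C,
        forall r (Z X : 'M_(r, N)),
          run C (row_mx Z X) = row_mx (Z *m V') (X *m V),
        V' *m (map_mx conjD V)^T = 1%:M
      & forall r (Z : 'M_(r, N)), (forall i j, P j -> Z i j = 0) ->
          Z *m V' = Z].

Lemma cnot_circuit1 N (P : pred 'I_N) : cnot_circuit P 1%:M 1%:M.
Proof.
exists [::]; split=> // [r Z X||r Z _]; rewrite ?mulmx1 //.
by rewrite map_mx1 trmx1 mul1mx.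
Qed.

Lemma cnot_circuitM N (P : pred 'I_N) V1' V1 V2' V2 :
  cnot_circuit P V1' V1 -> cnot_circuit P V2' V2 ->
  cnot_circuit P (V1' *m V2') (V1 *m V2).
Proof.
move=> [C1 [i1 r1 s1 z1]] [C2 [i2 r2 s2 z2]]; exists (C1 ++ C2); split.
- by rewrite all_cat i1.
- by move=> r Z X; rewrite run_cat r1 r2 !mulmxA.
- by rewrite map_mxM trmx_mul -mulmxA (mulmxA V2') s2 mul1mx.
- by move=> r Z hZ; rewrite mulmxA z1 // z2.
Qed.

Lemma cnot_circuit_sub N (P Q : pred 'I_N) V' V :
  subpred P Q -> cnot_circuit P V' V -> cnot_circuit Q V' V.
Proof.
move=> sPQ [C [iC rC sC zC]]; exists C; split=> // r Z hZ.
by apply: zC => i j /sPQ; apply: hZ.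
Qed.

Lemma cnot_circuit_CNOT N (P : pred 'I_N) i j k :
  i != j -> P i -> P j ->
  cnot_circuit P (1%:M + D ^ (- k) *: delta_mx j i)
                 (1%:M + D ^ k *: delta_mx i j).
Proof.
move=> ij Pi Pj; exists [:: CNOT k ij]; split=> //=.
- by move=> r Z X; rewrite row_mxKl row_mxKr.
- rewrite map_mxD map_mx1 map_mxZ map_delta_mx linearD linearZ /= trmx1.
  rewrite trmx_delta conjD_Dexp -[RHS](@addcol_mxK _ _ 1%:M j i (D ^ (- k))).
    by rewrite mul1mx.
  by rewrite eq_sym.
- move=> r Z Z0; rewrite mulmxDr mulmx1 -scalemxAr -[RHS]addr0; congr (_ + _).
  apply/matrixP=> u v; rewrite !mxE big1 ?mulr0 // => w _; rewrite !mxE.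
  by case: eqP => [->|_]; rewrite ?mulr0 // Z0 ?mul0r.
Qed.

Lemma cnot_circuit_Swap N (P : pred 'I_N) i j :
  P i -> P j -> cnot_circuit P (tperm_mx i j) (tperm_mx i j).
Proof.
move=> Pi Pj; exists [:: Swap i j]; split=> //=.
- by move=> r Z X; rewrite row_mxKl row_mxKr !xcolE.
- by rewrite map_tperm_mx tr_tperm_mx -[X in X *m _]mul1mx -!xcolE xcolK.
- move=> r Z Z0; rewrite -xcolE; apply/matrixP=> u v; rewrite !mxE.
  by case: tpermP => [->|->|//]; rewrite !Z0.
Qed.

(* Since no qubit is both a control and a target, the elementary CNOTs below
   multiply by adding their off-diagonal parts. *)
Lemma cnot_circuit_poly N (P A B : pred 'I_N) (g : 'M[{poly 'F_2}]_N) :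
  subpred A P -> subpred B P -> (forall i, A i -> ~~ B i) ->
  (forall i j, g i j != 0 -> A i && B j) ->
  cnot_circuit P (1%:M + (map_mx atDinv g)^T) (1%:M + map_mx atD g).
Proof.
move=> AP BP AB.
(* This property is additive in [g]: the support condition makes the product of two such matrices
   vanish. It therefore suffices to treat monomial multiples of the matrix units, which are single
   CNOTs. *)
pose K (g : 'M[{poly 'F_2}]_N) := (forall i j, g i j != 0 -> A i && B j) /\
  cnot_circuit P (1%:M + (map_mx atDinv g)^T) (1%:M + map_mx atD g).
have K0 : K 0.
  split=> [i j|]; first by rewrite mxE eqxx.
  by rewrite !map_mx0 trmx0 !addr0; apply: cnot_circuit1.
have KD g1 g2 : K g1 -> K g2 -> K (g1 + g2).
  move=> [s1 c1] [s2 c2]; split=> [i j|].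
    rewrite mxE; case: (eqVneq (g1 i j) 0) => [->|/s1 //].
    by rewrite add0r => /s2.
  have g12 : g1 *m g2 = 0.
    apply/matrixP=> i j; rewrite !mxE big1 // => l _.
    case: (eqVneq (g1 i l) 0) => [->|/s1/andP[_ Bl]]; first by rewrite mul0r.
    case: (eqVneq (g2 l j) 0) => [->|/s2/andP[/AB]]; first by rewrite mulr0.
    by rewrite Bl.
  have g21 : g2 *m g1 = 0.
    apply/matrixP=> i j; rewrite !mxE big1 // => l _.
    case: (eqVneq (g2 i l) 0) => [->|/s2/andP[_ Bl]]; first by rewrite mul0r.
    case: (eqVneq (g1 l j) 0) => [->|/s1/andP[/AB]]; first by rewrite mulr0.
    by rewrite Bl.
  have := cnot_circuitM c1 c2; congr cnot_circuit.
    rewrite mulmxDr mulmx1 mulmxDl mul1mx -trmx_mul -map_mxM g21.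
    by rewrite map_mx0 trmx0 addr0 map_mxD linearD addrA.
  rewrite mulmxDr mulmx1 mulmxDl mul1mx -map_mxM g12.
  by rewrite map_mx0 addr0 map_mxD addrA.
have K1 i j (k : nat) : A i -> B j -> K ('X^k *: delta_mx i j).
  move=> Ai Bj; split=> [u v|].
    by rewrite !mxE; case: (u =P i) => [->|] /=; case: (v =P j) => [->|];
      rewrite ?mulr0 ?eqxx ?Ai.
  have ij : i != j by apply: contraTneq Bj => <-; apply: AB.
  rewrite !map_mxZ !map_delta_mx linearZ /= trmx_delta.
  have := cnot_circuit_CNOT k ij (AP _ Ai) (BP _ Bj).
  by rewrite !rmorphXn /= [atDinv 'X]atDinvE map_polyX hornerX -exprnN exprVn.
have Kp i j (p : {poly 'F_2}) : A i -> B j -> K (p *: delta_mx i j).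
  move=> Ai Bj; rewrite -[p]coefK poly_def scaler_suml.
  apply: big_ind => // k _; case: (eqVneq p`_k 0) => [->|pk].
    by rewrite scale0r scale0r.
  have -> : p`_k = 1 by case: (p`_k) pk => [[|[]]] // ? _; apply: val_inj.
  by rewrite scale1r; apply: K1.
move=> hg; suff [] : K g by [].
rewrite [g]matrix_sum_delta; apply: big_ind => // i _; apply: big_ind => // j _.
case: (eqVneq (g i j) 0) => [->|/hg/andP[Ai Bj]]; first by rewrite scale0r.
exact: Kp.
Qed.

(** * Polynomial column reduction *)

(** The denominators are taken after conjugation, which leaves polynomials in 1/D: these are the
    coefficients by which CNOTs act on the Z side. *)
Lemma common_denominator (I : finType) (x : I -> F2rat) :
  exists (d : {poly 'F_2}) (w : I -> {poly 'F_2}),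
    d != 0 /\ forall i, x i = (atDinv d)^-1 * atDinv (w i).
Proof.
exists (\prod_i denom (conjD (x i))).
exists (fun i => numer (conjD (x i)) * \prod_(j | j != i) denom (conjD (x j))).
split=> [|i]; first by apply/prodf_neq0 => i _; apply: denom_neq0.
have R0 : atDinv (\prod_(j | j != i) denom (conjD (x j))) != 0.
  by rewrite atDinv_eq0; apply/prodf_neq0 => j _; apply: denom_neq0.
rewrite (bigD1 i) //= !rmorphM /= invfM -mulrA [atDinv (numer _) * _]mulrC mulKf //.
by apply: (can_inj conjDK); rewrite [LHS]numer_denom mulrC rmorphM fmorphV /=
  !conjD_atDinv.
Qed.

(* The Euclidean algorithm on the entries in [P] of a row. *)
Lemma row_reduction N (P : pred 'I_N) (t : 'I_N) (z : 'rV[F2rat]_N) : P t ->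
  exists V' V, cnot_circuit P V' V /\
    forall j, P j -> j != t -> (z *m V') 0 j = 0.
Proof.
move=> Pt; have [d [w [d0 zE]]] := common_denominator (fun j => z 0 j).
have {zE} : forall j, P j -> z 0 j = (atDinv d)^-1 * atDinv (w j) by move=> j _.
(* The total size of the numerators in [P] decreases with each division step. *)
have [m] := ubnP (\sum_(j | P j) size (w j)).
elim: m z w => // m IH z w mw zE.
case: (pickP (fun u : 'I_N * 'I_N => [&& P u.1, P u.2, u.1 != u.2, w u.1 != 0,
    w u.2 != 0 & (size (w u.1) <= size (w u.2))%N])).
  move=> [i j] /= /and5P[Pi Pj ij wi /andP[wj leij]].
  (* On the Z side, a CNOT from [j] to [i] adds a multiple of column [i] to column [j]. With the
     quotient as coefficient it replaces [w j] by its remainder modulo [w i], as signs do not matter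
     in characteristic 2. *)
  pose q := w j %/ w i; pose g : 'M[{poly 'F_2}]_N := q *: delta_mx j i.
  pose V1' := 1%:M + (map_mx atDinv g)^T; pose V1 := 1%:M + map_mx atD g.
  have c1 : cnot_circuit P V1' V1.
    apply: (@cnot_circuit_poly _ P (pred1 j) (pred1 i))
      => [u /eqP->|u /eqP->|u /eqP->|u v] //=.
      by rewrite eq_sym.
    rewrite !mxE; by case: (u == j); case: (v == i); rewrite //= mulr0 eqxx.
  have zV1 l : (z *m V1') 0 l = z 0 l + (l == j)%:R * (z 0 i * atDinv q).
    rewrite mulmxDr mulmx1 !mxE (bigD1 i) //= big1 ?addr0 => [|u ui].
      rewrite !mxE eqxx andbT; case: (l == j); rewrite ?mulr1 ?mul1r //.
      by rewrite mulr0 rmorph0 mulr0 mul0r.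
    by rewrite !mxE (negPf ui) andbF mulr0 rmorph0 mulr0.
  have [|l Pl|V2' [V2 [c2 hz]]] :=
      IH (z *m V1') (fun l => if l == j then w j %% w i else w l).
  - rewrite ltnS in mw; apply: leq_trans mw.
    rewrite (bigD1 j) // [X in (_ < X)%N](bigD1 j) //= eqxx.
    rewrite -addSn leq_add //.
      by apply: leq_trans leij; rewrite ltn_modp.
    by apply: leq_sum => l /andP[_ /negPf->].
  - rewrite zV1 !zE //; case: eqP => [->|_]; last by rewrite mul0r addr0.
    rewrite mul1r -mulrA -mulrDr -rmorphM -rmorphD /= {1}(divp_eq (w j) (w i)).
    by rewrite addrAC -/q [w i * q]mulrC F2_poly_add_self add0r.
  exists (V1' *m V2'), (V1 *m V2); split; first exact: cnot_circuitM.
  by move=> l Pl lt; rewrite mulmxA hz.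
(* At most one entry in [P] is now nonzero, and a SWAP moves it to [t]. *)
move=> small; have one i j : P i -> P j -> w i != 0 -> w j != 0 -> i = j.
  move=> Pi Pj wi wj; apply/eqP; apply: contraT => ij.
  have := small (i, j); have := small (j, i); rewrite /= Pi Pj ij wi wj eq_sym ij /=.
  by case/orP: (leq_total (size (w i)) (size (w j))) => ->.
case: (pickP (fun i => P i && (w i != 0))) => [i /andP[Pi wi]|w0]; last first.
  exists 1%:M, 1%:M; split=> [|j Pj _]; first exact: cnot_circuit1.
  rewrite mulmx1 zE //; have := w0 j; rewrite Pj /= => /negbFE/eqP->.
  by rewrite rmorph0 mulr0.
exists (tperm_mx i t), (tperm_mx i t); split; first exact: cnot_circuit_Swap.
move=> j Pj jt; rewrite -xcolE mxE.
have hP : P (tperm i t j) by case: tpermP => // ->.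
rewrite zE //; case: (eqVneq (w (tperm i t j)) 0) => [->|wj].
  by rewrite rmorph0 mulr0.
have /(congr1 (tperm i t)) := one _ _ Pi hP wi wj.
by rewrite tpermL tpermK => tj; rewrite tj eqxx in jt.
Qed.

(** Rows are treated by increasing key, each with [row_reduction] on the columns of key at least its
    own. The earlier rows vanish on these columns, so the last clause of [cnot_circuit] leaves them
    unchanged. *)
Lemma hermite_form N (f : 'I_N -> nat) (M : 'M[F2rat]_N) : injective f ->
  exists W' W, cnot_circuit predT W' W /\
    forall i j, (f i < f j)%N -> (M *m W') i j = 0.
Proof.
move=> finj.
suff H m : exists W' W, cnot_circuit predT W' W /\
    forall i j, (f i < m)%N -> (f i < f j)%N -> (M *m W') i j = 0.
  have [W' [W [cW hW]]] := H (\max_i f i).+1; exists W', W; split=> // i j.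
  by apply: hW; rewrite ltnS; apply: leq_bigmax.
elim: m => [|m [W' [W [cW hW]]]].
  by exists 1%:M, 1%:M; split=> //; apply: cnot_circuit1.
case: (pickP (fun i => f i == m)) => [t /eqP ft|noi]; last first.
  exists W', W; split=> // i j; rewrite ltnS leq_eqVlt noi; exact: hW.
have [|V' [V [cV hV]]] := @row_reduction N (fun j => m <= f j)%N t (row t (M *m W')).
  by rewrite ft.
exists (W' *m V'), (W *m V); split.
  apply: cnot_circuitM => //; exact: cnot_circuit_sub cV.
move=> i j; rewrite ltnS leq_eqVlt mulmxA => /orP[/eqP fi ij|fi ij].
  have -> : i = t by apply: finj; rewrite fi ft.
  have := hV j; rewrite -row_mul mxE; apply; first by rewrite -fi ltnW.
  by apply: contraTneq ij => ->; rewrite ft fi ltnn.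
have [C [_ _ _ zC]] := cV.
have -> : ((M *m W' *m V') i j) = (row i (M *m W') *m V') 0 j.
  by rewrite -row_mul [RHS]mxE.
rewrite zC => [|u v fv]; rewrite [LHS]mxE hW //.
exact: leq_trans fv.
Qed.

(** If a diagonal entry vanished, so would every term of the determinant: a permutation that raises
    the key somewhere meets a zero entry, and one that never raises it preserves it, because the
    sums of keys agree, and so fixes every index. *)
Lemma keyed_trig_diag N (f : 'I_N -> nat) (T : 'M[F2rat]_N) : injective f ->
  (forall i j, (f i < f j)%N -> T i j = 0) -> T \in unitmx ->
  forall i, T i i != 0.
Proof.
move=> finj hT; rewrite unitmxE unitfE => dT i; apply: contraNneq dT => Tii.
rewrite /determinant big1 // => s _.
case: (pickP (fun j => f j < f (s j))%N) => [j fj|le_f].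
  by rewrite (bigD1 j) //= hT // mul0r mulr0.
have fs : f (s i) = f i.
  apply/eqP; rewrite eqn_leq leqNgt le_f /= leqNgt; apply/negP => lt_i.
  have : (\sum_j f (s j) < \sum_j f j)%N.
    rewrite (bigD1 i) //= [X in (_ < X)%N](bigD1 i) //= -addSn leq_add //.
    by apply: leq_sum => j _; rewrite leqNgt le_f.
  by rewrite [X in (_ < X)%N](reindex_inj (@perm_inj _ s)) ltnn.
by rewrite (bigD1 i) //= (finj _ _ fs) Tii mul0r mulr0.
Qed.

(** * A common normal form for the two check matrices *)

Lemma basis_of_rank (F : fieldType) a m n (X : 'M[F]_(m, n)) : \rank X = a :> nat ->
  exists N : 'M[F]_(a, n), (N :=: X)%MS.
Proof. by move=> <-; exists (row_base X); apply: eq_row_base. Qed.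

(* Columns are split as c + (a1 + a2 + k); the key makes the blocks appear in
   the order a1, k, c, a2. *)
Definition flag_key c a1 a2 k (q : 'I_(c + (a1 + a2 + k))) : nat :=
  if (q < c)%N then (a1 + k + q)%N
  else if (q < c + a1)%N then (q - c)%N
  else if (q < c + a1 + a2)%N then (k + q)%N
  else (q - c - a2)%N.

Lemma flag_key_inj c a1 a2 k : injective (@flag_key c a1 a2 k).
Proof.
move=> [p hp] [q hq]; rewrite /flag_key /= => e; apply: val_inj => /=.
by move: e; do ?case: ifP; lia.
Qed.

Lemma map_conjDK m n (A : 'M[F2rat]_(m, n)) :
  map_mx conjD (map_mx conjD A) = A.
Proof. by apply/matrixP=> i j; rewrite !mxE conjDK. Qed.

Lemma flag_key_c c a1 a2 k (i : 'I_c) :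
  flag_key (lshift (a1 + a2 + k) i) = (a1 + k + i)%N.
Proof. by rewrite /flag_key /= ltn_ord. Qed.

Lemma flag_key_a1 c a1 a2 k (i : 'I_a1) :
  flag_key (rshift c (lshift k (lshift a2 i))) = i.
Proof.
rewrite /flag_key /=; have := ltn_ord i; move: (nat_of_ord i) => m.
by do ?case: ifP; lia.
Qed.

Lemma flag_key_a2 c a1 a2 k (i : 'I_a2) :
  flag_key (rshift c (lshift k (rshift a1 i))) = (a1 + k + c + i)%N.
Proof.
rewrite /flag_key /=; have := ltn_ord i; move: (nat_of_ord i) => m.
by do ?case: ifP; lia.
Qed.

Lemma flag_key_k c a1 a2 k (i : 'I_k) :
  flag_key (rshift c (rshift (a1 + a2) i)) = (a1 + i)%N.
Proof.
rewrite /flag_key /=; have := ltn_ord i; move: (nat_of_ord i) => m.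
by do ?case: ifP; lia.
Qed.

Definition flag_keyE := (flag_key_c, flag_key_a1, flag_key_a2, flag_key_k).

Lemma hsubmx4K (R : Type) r c a1 a2 k (A : 'M[R]_(r, c + (a1 + a2 + k))) :
  A = row_mx (lsubmx A)
        (row_mx (row_mx (lsubmx (lsubmx (rsubmx A)))
                        (rsubmx (lsubmx (rsubmx A))))
                (rsubmx (rsubmx A))).
Proof. by rewrite !hsubmxK. Qed.

(** The successive quotients of the flag [Zs :&: K], [K], [K + Zs], whole space have dimensions a1,
    k, c, a2. Triangularity along the flag shapes [Zs]; orthogonality to [K], which the pair [W'],
    [W] preserves, shapes [Xs]. *)
Lemma normal_form c a1 a2 k r1 r2 (Zs : 'M[F2rat]_(r1, c + (a1 + a2 + k)))
    (Xs : 'M[F2rat]_(r2, c + (a1 + a2 + k))) :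
  \rank Zs = (c + a1)%N :> nat -> \rank Xs = (c + a2)%N :> nat ->
  \rank (Zs *m (map_mx conjD Xs)^T) = c :> nat ->
  exists W' W, cnot_circuit predT W' W /\
    exists (F : 'M_(c, k)) zc z1 xc x2,
      Zs *m W' = row_mx zc (row_mx (row_mx z1 0) (zc *m F)) /\
      Xs *m W = row_mx xc (row_mx (row_mx 0 x2) 0).
Proof.
set n := (c + (a1 + a2 + k))%N => rZ rX rZX.
pose K := kermx (map_mx conjD Xs)^T.
have rK : \rank K = (a1 + k)%N :> nat.
  rewrite mxrank_ker mxrank_tr mxrank_map rX /n; lia.
have rZK : \rank (Zs :&: K)%MS = a1 :> nat.
  by have := mxrank_mul_ker Zs (map_mx conjD Xs)^T; rewrite rZX rZ -/K; lia.
have [N1 eN1] := basis_of_rank rZK.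
have [N2 eN2] : exists N : 'M[F2rat]_(k, n), (N :=: K :\: Zs)%MS.
  apply: basis_of_rank; have := mxrank_cap_compl K Zs.
  by rewrite capmxC rZK rK => /addnI.
have [N3 eN3] : exists N : 'M[F2rat]_(c, n), (N :=: Zs :\: K)%MS.
  apply: basis_of_rank; have := mxrank_cap_compl Zs K.
  by rewrite rZK rZ [RHS]addnC => /addnI.
have [N4 eN4] : exists N : 'M[F2rat]_(a2, n), (N :=: (K + Zs)^C)%MS.
  apply: basis_of_rank; rewrite mxrank_compl.
  have := mxrank_sum_cap K Zs; rewrite capmxC rZK rK rZ.
  by move: (\rank (K + Zs)%MS) => r; rewrite /n; lia.
(* The bases are stacked in the order of the column blocks, so that [flag_key] orders rows and
   columns alike. *)
pose M : 'M_n := col_mx N3 (col_mx (col_mx N1 N4) N2).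
have eM : (M :=: N3 + (N1 + N4 + N2))%MS.
  apply: eqmx_trans (eqmx_sym (addsmxE _ _)) (adds_eqmx (eqmx_refl _) _).
  apply: eqmx_trans (eqmx_sym (addsmxE _ _)) (adds_eqmx _ (eqmx_refl _)).
  exact: eqmx_sym (addsmxE _ _).
have leZ : (Zs <= N3 + N1)%MS.
  by rewrite -(addsmx_diff_cap_eq Zs K) addsmxS // ?eN3 ?eN1.
have leK : (K <= N2 + N1)%MS.
  by rewrite -(addsmx_diff_cap_eq K Zs) addsmxS // ?eN2 // eN1 capmxC.
have uM : M \in unitmx.
  rewrite -row_full_unit -sub1mx.
  apply: submx_trans (_ : (K + Zs + (K + Zs)^C <= M)%MS).
    by rewrite sub1mx addsmx_compl_full.
  have [h1 h2 h3 h4] : [/\ N1 <= M, N2 <= M, N3 <= M & N4 <= M]%MS.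
    have := submx_refl M; rewrite {1}eM !addsmx_sub.
    by case/and3P=> -> /andP[-> ->] ->.
  rewrite !addsmx_sub (submx_trans leK) ?addsmx_sub ?h1 ?h2 //.
  by rewrite (submx_trans leZ) ?addsmx_sub ?h1 ?h3 // -eN4.
have [W' [W [cW hT]]] := hermite_form M (@flag_key_inj c a1 a2 k).
exists W', W; split=> //; set T := M *m W' in hT.
have [C [_ _ sW _]] := cW.
have uT : T \in unitmx.
  have [uW' _] := mulmx1_unit sW.
  by rewrite /T unitmx_mul uM uW'.
have T0 := keyed_trig_diag (@flag_key_inj c a1 a2 k) hT uT.
have TE : T = col_mx (N3 *m W') (col_mx (col_mx (N1 *m W') (N4 *m W')) (N2 *m W')).
  by rewrite /T /M !mul_col_mx.
(* Block indices follow the flag: 1 for a1, 2 for k, 3 for c, 4 for a2. *)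
pose T33 := lsubmx (N3 *m W').
have trigT33 : is_trig_mx T33.
  apply/is_trig_mxP => i j ij; rewrite mxE.
  have := hT (lshift _ i) (lshift _ j); rewrite TE col_mxEu; apply.
  by rewrite !flag_key_c ltn_add2l.
have uT33 : T33 \in unitmx.
  rewrite unitmxE unitfE (det_trig trigT33); apply/prodf_neq0 => i _.
  by have := T0 (lshift _ i); rewrite TE col_mxEu /T33 [lsubmx _ i i]mxE.
pose T31 := lsubmx (lsubmx (rsubmx (N3 *m W'))).
pose T32 := rsubmx (rsubmx (N3 *m W')).
have N3E : N3 *m W' = row_mx T33 (row_mx (row_mx T31 0) T32).
  rewrite [LHS]hsubmx4K.
  congr (row_mx _ (row_mx (row_mx _ _) _)); apply/matrixP => i j.
  rewrite 3![LHS]mxE [RHS]mxE.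
  have := hT (lshift _ i) (rshift _ (lshift _ (rshift _ j))).
  rewrite TE col_mxEu => -> //.
  by rewrite flag_key_c flag_key_a2 -(addnA (a1 + k)%N) ltn_add2l ltn_addr.
pose T11 := lsubmx (lsubmx (rsubmx (N1 *m W'))).
have N1E : N1 *m W' = row_mx 0 (row_mx (row_mx T11 0) 0).
  rewrite [LHS]hsubmx4K.
  have N1T i j : (N1 *m W') i j = T (rshift _ (lshift _ (lshift _ i))) j.
    by rewrite TE col_mxEd !col_mxEu.
  congr (row_mx _ (row_mx (row_mx _ _) _)); apply/matrixP => i j;
    [rewrite [LHS]mxE | rewrite 3![LHS]mxE | rewrite 2![LHS]mxE];
    rewrite [RHS]mxE N1T hT // !flag_keyE;
    by have := ltn_ord i; move: (nat_of_ord i) (nat_of_ord j) => u v; lia.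
(* In the columns c and k only the [N3] part of [Zs] survives, with blocks [u *m T33] and
   [u *m T32]; this factor carries the first to the second. *)
exists (invmx T33 *m T32).
have [[u v] /= Zuv] := sub_addsmxP leZ.
exists (u *m T33), (u *m T31 + v *m T11).
(* Strong induction on the key. Row [j] of [M] lies in [K], so [Xs *m W] is orthogonal to row [j] of
   [T]; columns of smaller key drop out by induction and those of larger key by triangularity, which
   leaves the entry times a nonzero diagonal term. *)
have XE : forall r j, (flag_key j < a1 + k)%N -> (Xs *m W) r j = 0.
  move=> r j; move: {2}(flag_key j) (erefl (flag_key j)) => m.
  elim/ltn_ind: m j => m IH j fj; rewrite fj => mlt.
  have Kj : (row j M <= K)%MS.
    rewrite /M; move: fj mlt; case: (split_ordP j) => [i ->|{}j ->].
      by rewrite flag_key_c => <-; rewrite -ltn_subRL subnn.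
    case: (split_ordP j) => [{}j ->|i ->]; rewrite !rowKd; last first.
      move=> _ _; apply: submx_trans (row_sub _ _) _.
      by rewrite eN2 diffmxSl.
    case: (split_ordP j) => i ->; rewrite rowKu.
      move=> _ _; rewrite rowKu; apply: submx_trans (row_sub _ _) _.
      by rewrite eN1 capmxSr.
    by rewrite flag_key_a2 => <-; rewrite -addnA -ltn_subRL subnn.
  have XT : Xs *m W *m (map_mx conjD (row j T))^T = 0.
    have sW' : W *m (map_mx conjD W')^T = 1%:M.
      have WW' : W^T *m map_mx conjD W' = 1%:M.
        by rewrite -(map_mx1 conjD) -(mulmx1C sW) map_mxM map_trmx map_conjDK.
      by apply: mulmx1C; rewrite -[W in _ *m W]trmxK -trmx_mul WW' trmx1.
    rewrite /T row_mul map_mxM trmx_mul mulmxA -(mulmxA Xs) sW' mulmx1.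
    apply: trmx_inj; rewrite trmx_mul trmxK trmx0.
    rewrite -(map_mx0 conjD) -(sub_kermxP Kj) map_mxM map_trmx.
    by rewrite map_conjDK.
  have := congr1 (fun A : 'M_(r2, 1) => A r 0) XT.
  have TjE l : (map_mx conjD (row j T))^T l 0 = conjD (T j l).
    by rewrite [LHS]mxE [LHS]mxE; congr conjD; rewrite [LHS]mxE.
  rewrite mxE [RHS]mxE (bigD1 j) //= big1 ?addr0 => [|l lj]; rewrite TjE; last first.
    case: (ltngtP (flag_key l) (flag_key j)) => [lt|lt|/flag_key_inj e].
    - have -> : (Xs *m W) r l = 0 by apply: (IH (flag_key l)) => //; lia.
      by rewrite mul0r.
    - by rewrite hT // rmorph0 mulr0.
    by rewrite e eqxx in lj.
  by move/eqP; rewrite mulf_eq0 fmorph_eq0 (negPf (T0 j)) orbF => /eqP.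
exists (lsubmx (Xs *m W)), (rsubmx (lsubmx (rsubmx (Xs *m W)))); split.
  rewrite Zuv mulmxDl -!mulmxA N3E N1E !mul_mx_row !add_row_mx !mulmx0 !addr0.
  by rewrite mulKVmx.
rewrite [LHS]hsubmx4K.
congr (row_mx _ (row_mx (row_mx _ _) _)); apply/matrixP => i j;
  [rewrite 3![LHS]mxE | rewrite 2![LHS]mxE]; rewrite [RHS]mxE XE // flag_keyE;
  by have := ltn_ord j; move: (nat_of_ord j) => l; lia.
Qed.

(** * Circuits on Alice's qubits *)

Lemma rshift_neq c n (i j : 'I_n) : i != j -> rshift c i != rshift c j.
Proof. by rewrite (inj_eq (@rshift_inj _ _)). Qed.

Definition alice_op c n (o : operation n) : operation (c + n) :=
  match o with
  | CNOT i j k ij => CNOT k (rshift_neq c ij)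
  | Hadamard i => Hadamard (rshift c i)
  | Swap i j => Swap (rshift c i) (rshift c j)
  | Delay i l => Delay (rshift c i) l
  | InfDepth i l p p0 => InfDepth (rshift c i) l p0
  end.

Lemma alice_op_within c n (o : operation n) :
  acts_within (@alice c n) (alice_op c o).
Proof. by case: o => * /=; rewrite /alice /= !leq_addr. Qed.

Lemma finite_depth_alice_op c n (o : operation n) :
  finite_depth (alice_op c o) = finite_depth o.
Proof. by case: o. Qed.

Lemma mul_delta_mxE N M r (Z : 'M[F2rat]_(r, N)) (i : 'I_N) (j : 'I_M) u v :
  (Z *m delta_mx i j) u v = Z u i * (v == j)%:R.
Proof.
rewrite mxE (bigD1 i) //= big1 ?addr0 => [|l li]; first by rewrite mxE eqxx.
by rewrite mxE (negPf li) mulr0.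
Qed.

Lemma mul_addcol_rshift c n r (A : 'M[F2rat]_(r, c)) (B : 'M_(r, n)) i j a :
  row_mx A B *m addcol_mx (rshift c i) (rshift c j) a =
  row_mx A (B *m addcol_mx i j a).
Proof.
rewrite /addcol_mx !mulmxDr !mulmx1 -!scalemxAr.
have -> : row_mx A B *m delta_mx (rshift c i) (rshift c j) =
          row_mx 0 (B *m delta_mx i j).
  apply/matrixP=> u v; rewrite mul_delta_mxE row_mxEr.
  case: (split_ordP v) => w ->; rewrite ?row_mxEl ?row_mxEr.
    by rewrite mxE eq_lrshift mulr0.
  by rewrite mul_delta_mxE (inj_eq (@rshift_inj _ _)).
by rewrite scale_row_mx scaler0 add_row_mx addr0.
Qed.

Lemma mul_scalecol_mxE N r (Z : 'M[F2rat]_(r, N)) i a u v :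
  (Z *m scalecol_mx i a) u v = Z u v * (if v == i then a else 1).
Proof. by rewrite /scalecol_mx mul_mx_diag !mxE. Qed.

Lemma mul_scalecol_rshift c n r (A : 'M[F2rat]_(r, c)) (B : 'M_(r, n)) i a :
  row_mx A B *m scalecol_mx (rshift c i) a = row_mx A (B *m scalecol_mx i a).
Proof.
apply/matrixP=> u v; rewrite mul_scalecol_mxE; case: (split_ordP v) => w ->.
  by rewrite !row_mxEl eq_lrshift mulr1.
by rewrite !row_mxEr mul_scalecol_mxE (inj_eq (@rshift_inj _ _)).
Qed.

Lemma xcol_rshift c n r (A : 'M[F2rat]_(r, c)) (B : 'M_(r, n)) i j :
  xcol (rshift c i) (rshift c j) (row_mx A B) = row_mx A (xcol i j B).
Proof.
apply/matrixP=> u v; rewrite mxE; case: (split_ordP v) => w ->.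
  by rewrite tpermD ?row_mxEl // eq_sym eq_lrshift.
by rewrite -inj_tperm ?row_mxEr ?mxE //; apply: rshift_inj.
Qed.

Lemma apply_HadamardE N r (Z X : 'M[F2rat]_(r, N)) i :
  apply_op (row_mx Z X) (Hadamard i) =
  row_mx (\matrix_(u, v) (if v == i then X else Z) u v)
         (\matrix_(u, v) (if v == i then Z else X) u v).
Proof.
apply/matrixP=> u v; rewrite mxE; case: (split_ordP v) => w ->.
  rewrite row_mxEl mxE; case: (eqVneq w i) => [->|wi].
    by rewrite tpermL row_mxEr.
  rewrite tpermD ?row_mxEl // eq_sym; first by rewrite (inj_eq (@lshift_inj _ _)).
  by rewrite eq_lrshift.
rewrite row_mxEr mxE; case: (eqVneq w i) => [->|wi].
  by rewrite tpermR row_mxEl.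
rewrite tpermD ?row_mxEr // eq_sym; first by rewrite eq_rlshift.
by rewrite (inj_eq (@rshift_inj _ _)).
Qed.

Lemma apply_alice_op c n r (Zb Xb : 'M_(r, c)) (Za Xa : 'M_(r, n)) o :
  apply_op (row_mx (row_mx Zb Za) (row_mx Xb Xa)) (alice_op c o) =
  row_mx (row_mx Zb (lsubmx (apply_op (row_mx Za Xa) o)))
         (row_mx Xb (rsubmx (apply_op (row_mx Za Xa) o))).
Proof.
case: o => [i j k ij|i|i j|i l|i l p p0].
- by rewrite /= !row_mxKl !row_mxKr !mul_addcol_rshift.
- rewrite [alice_op _ _]/= !apply_HadamardE row_mxKl row_mxKr.
  congr row_mx; apply/matrixP=> u v; rewrite mxE; case: (split_ordP v) => w ->;
    by rewrite ?(row_mxEl, row_mxEr, eq_lrshift, inj_eq (@rshift_inj _ _)) // mxE;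
      case: ifP; rewrite ?(row_mxEl, row_mxEr).
- by rewrite /= !row_mxKl !row_mxKr !xcol_rshift.
- by rewrite /= !row_mxKl !row_mxKr !mul_scalecol_rshift.
- by rewrite /= !row_mxKl !row_mxKr !mul_scalecol_rshift.
Qed.

Lemma run_alice_op c n r (Zb Xb : 'M_(r, c)) (Za Xa : 'M_(r, n)) C :
  run (map (alice_op c (n:=n)) C) (row_mx (row_mx Zb Za) (row_mx Xb Xa)) =
  row_mx (row_mx Zb (lsubmx (run C (row_mx Za Xa))))
         (row_mx Xb (rsubmx (run C (row_mx Za Xa)))).
Proof.
elim: C Za Xa => [|o C IH] Za Xa; first by rewrite /= row_mxKl row_mxKr.
by rewrite [LHS]/= apply_alice_op IH hsubmxK.
Qed.

Lemma alice_columns_run c n r (W : 'M_(r, (c + n) + (c + n))) C :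
  alice_columns (run (map (alice_op c (n:=n)) C) W) = run C (alice_columns W).
Proof.
rewrite -[W]hsubmxK; move: (lsubmx W) (rsubmx W) => Z X.
rewrite -[Z]hsubmxK -[X]hsubmxK run_alice_op /alice_columns.
by rewrite !(row_mxKl, row_mxKr) hsubmxK.
Qed.

Lemma run_cons N r (W : 'M[F2rat]_(r, N + N)) o C :
  run (o :: C) W = run C (apply_op W o).
Proof. by []. Qed.

Lemma run_Hadamard N r (P : pred 'I_N) (Z X : 'M[F2rat]_(r, N)) :
  run (map (@Hadamard N) (enum P)) (row_mx Z X) =
  row_mx (\matrix_(u, v) (if P v then X else Z) u v)
         (\matrix_(u, v) (if P v then Z else X) u v).
Proof.
have H s : uniq s -> run (map (@Hadamard N) s) (row_mx Z X) =
  row_mx (\matrix_(u, v) (if v \in s then X else Z) u v)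
         (\matrix_(u, v) (if v \in s then Z else X) u v).
  elim: s Z X => [|i s IH] Z1 X1.
    by move=> _; congr row_mx; apply/matrixP=> u v; rewrite mxE.
  rewrite cons_uniq => /andP[his us].
  rewrite map_cons [LHS]run_cons apply_HadamardE IH //.
  congr row_mx; apply/matrixP=> u v; rewrite [LHS]mxE [RHS]mxE inE;
    (case: (eqVneq v i) => [->|/negPf vi] /=;
      [by rewrite (negPf his) mxE eqxx | by case: ifP; rewrite mxE vi]).
rewrite H ?enum_uniq //; congr row_mx; apply/matrixP=> u v;
  by rewrite !mxE mem_enum.
Qed.

Lemma run_InfDepth N r (P : pred 'I_N) (p : {poly 'F_2}) (p0 : p != 0)
    (Z X : 'M[F2rat]_(r, N)) :
  run [seq InfDepth i 0 p0 | i <- enum P] (row_mx Z X) =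
  row_mx (\matrix_(u, v) (if P v then atDinv p * Z u v else Z u v))
         (\matrix_(u, v) (if P v then (atD p)^-1 * X u v else X u v)).
Proof.
have H s : uniq s -> run [seq InfDepth i 0 p0 | i <- s] (row_mx Z X) =
  row_mx (\matrix_(u, v) (if v \in s then atDinv p * Z u v else Z u v))
         (\matrix_(u, v) (if v \in s then (atD p)^-1 * X u v else X u v)).
  elim: s Z X => [|i s IH] Z1 X1 /=.
    by move=> _; congr row_mx; apply/matrixP=> u v; rewrite mxE.
  move=> /andP[his us]; rewrite row_mxKl row_mxKr IH //.
  congr row_mx; apply/matrixP=> u v; rewrite [LHS]mxE [RHS]mxE inE;
    rewrite mul_scalecol_mxE; case: (eqVneq v i) => [->|_] /=;
    by rewrite ?(negPf his) ?mulr1 // expr0z mul1r mulrC.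
rewrite H ?enum_uniq //; congr row_mx; apply/matrixP=> u v;
  by rewrite !mxE mem_enum.
Qed.

(** The controls are the last m qubits and the targets the first c. The targets are Alice's halves
    of the ebits in the encoder and Bob's qubits in the decoder. *)
Lemma block_CNOTs c m (G : 'M[{poly 'F_2}]_(c, m)) :
  exists2 B : circuit (c + m), all (@involutive_op _) B &
    forall r (Z1 X1 : 'M_(r, c)) (Z2 X2 : 'M_(r, m)),
      run B (row_mx (row_mx Z1 Z2) (row_mx X1 X2)) =
      row_mx (row_mx Z1 (Z2 + Z1 *m map_mx atDinv G))
             (row_mx (X1 + X2 *m (map_mx atD G)^T) X2).
Proof.
pose g : 'M[{poly 'F_2}]_(c + m) := block_mx 0 0 G^T 0.
have [] := @cnot_circuit_poly _ predT (fun q => c <= q)%N (fun q => q < c)%N g.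
- by [].
- by [].
- by move=> i; rewrite -leqNgt.
- move=> i j; rewrite /g; case: (split_ordP i) => u ->; case: (split_ordP j) => v ->;
    rewrite ?(block_mxEul, block_mxEur, block_mxEdl, block_mxEdr) ?mxE ?eqxx //.
  by rewrite /= leq_addr.
move=> B [iB rB _ _]; exists B => // r Z1 X1 Z2 X2; rewrite rB.
rewrite !mulmxDr !mulmx1 /g !map_block_mx tr_block_mx !map_mx0 !trmx0.
rewrite !mul_row_block !mulmx0 !addr0 !add0r !add_row_mx !addr0.
by rewrite map_trmx trmxK map_trmx.
Qed.

(** Three layers: Hadamards turn the last a2 ancillas into X-type generators, CNOTs from the
    information qubits to the ebits bring in [G], and an infinite-depth operation scales every
    ebit. *)
Lemma encoder_rows c a1 a2 k (d : {poly 'F_2}) (G : 'M[{poly 'F_2}]_(c, k)) :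
  d != 0 ->
  exists E : circuit (c + (a1 + a2 + k)),
    ((0 < c)%N -> has (fun o => ~~ finite_depth o) E) /\
    forall r (Z1 X1 : 'M_(r, c)) (Za1 : 'M_(r, a1)) (Za2 : 'M_(r, a2))
        (Zk Xk : 'M_(r, k)),
      run E (row_mx (row_mx Z1 (row_mx (row_mx Za1 Za2) Zk))
                    (row_mx X1 (row_mx 0 Xk))) =
      row_mx
        (row_mx (atDinv d *: Z1)
                (row_mx (row_mx Za1 0) (Zk + Z1 *m map_mx atDinv G)))
        (row_mx ((atD d)^-1 *: (X1 + Xk *m (map_mx atD G)^T))
                (row_mx (row_mx 0 Za2) Xk)).
Proof.
move=> d0; set n := (c + (a1 + a2 + k))%N.
have [B _ rB] := block_CNOTs (row_mx 0 G : 'M_(c, a1 + a2 + k)).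
pose P (q : 'I_n) := (c + a1 <= q < c + a1 + a2)%N.
pose Q (q : 'I_n) := (q < c)%N.
exists (map (@Hadamard n) (enum P) ++ B ++ [seq InfDepth i 0 d0 | i <- enum Q]).
split.
  move=> c0; rewrite !has_cat; apply/orP; right; apply/orP; right.
  rewrite has_map; apply/hasP; exists (lshift _ (Ordinal c0)) => //.
  by rewrite mem_enum.
move=> r Z1 X1 Za1 Za2 Zk Xk; rewrite !run_cat run_Hadamard.
have Pc i : P (lshift _ i) = false by rewrite /P /=; have := ltn_ord i; lia.
have P1 i : P (rshift _ (lshift _ (lshift _ i))) = false.
  by rewrite /P /=; have := ltn_ord i; lia.
have P2 i : P (rshift _ (lshift _ (rshift _ i))) = true.
  by rewrite /P /=; have := ltn_ord i; lia.
have Pk i : P (rshift _ (rshift _ i)) = false by rewrite /P /=; lia.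
have Qc i : Q (lshift _ i) = true by rewrite /Q /= ltn_ord.
have Qr i : Q (rshift _ i) = false by rewrite /Q /=; lia.
set Z' := \matrix_(_, _) _; set X' := \matrix_(_, _) _.
have -> : Z' = row_mx Z1 (row_mx (row_mx Za1 0) Zk).
  apply/matrixP=> u v; rewrite mxE; case: (split_ordP v) => {}v ->.
    by rewrite Pc !row_mxEl.
  case: (split_ordP v) => {}v ->; last by rewrite Pk !row_mxEr.
  case: (split_ordP v) => {}v ->.
    by rewrite P1 !row_mxEr !row_mxEl.
  by rewrite P2 !(row_mxEr, row_mxEl) !mxE.
have -> : X' = row_mx X1 (row_mx (row_mx 0 Za2) Xk).
  apply/matrixP=> u v; rewrite mxE; case: (split_ordP v) => {}v ->.
    by rewrite Pc !row_mxEl.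
  case: (split_ordP v) => {}v ->; last by rewrite Pk !row_mxEr.
  case: (split_ordP v) => {}v ->.
    by rewrite P1 !(row_mxEr, row_mxEl) !mxE.
  by rewrite P2 !(row_mxEr, row_mxEl).
rewrite rB run_InfDepth; congr row_mx.
  apply/matrixP=> u v; rewrite mxE; case: (split_ordP v) => {}v ->.
    by rewrite Qc !row_mxEl mxE.
  rewrite Qr !row_mxEr map_row_mx map_mx0 mul_mx_row mulmx0 add_row_mx.
  by rewrite addr0.
apply/matrixP=> u v; rewrite mxE; case: (split_ordP v) => {}v ->.
  rewrite Qc !row_mxEl map_row_mx map_mx0 tr_row_mx trmx0 mul_row_col mulmx0.
  by rewrite add0r [RHS]mxE.
by rewrite Qr !row_mxEr.
Qed.

(** Full row rank of [M'] forces [U] to have rank s, and with s = r it is invertible; its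
    pseudo-inverse is a two-sided inverse of the right shape. *)
Lemma row_equivalent_mulmx r s q (M : 'M[F2rat]_(r, q)) (M' : 'M_(s, q)) U :
  s = r -> row_free M' -> M' = U *m M -> row_equivalent M M'.
Proof.
move=> sr fM' e; exists U, (pinvmx U).
have rU : (s <= \rank U)%N.
  by move: fM' => /eqP; rewrite e => {1}<-; apply: mxrankM_maxl.
have rUs : \rank U = s :> nat by apply/eqP; rewrite eqn_leq rank_leq_row.
split=> //; first by apply: mulmxVp; rewrite /row_free rUs.
by apply: mulVpmx; rewrite /row_full rUs sr.
Qed.

(** * Block forms of the unencoded matrices *)

Lemma ones_from_shift r l m s :
  ones_from r (l + m) (l + s) = row_mx 0 (ones_from r m s).
Proof.
apply/matrixP=> i j; rewrite mxE; case: (split_ordP j) => {}j ->.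
  rewrite row_mxEl mxE; case: eqP => //= e.
  by have := ltn_ord j; rewrite e -addnA ltnNge leq_addr.
by rewrite row_mxEr mxE /= -addnA eqn_add2l.
Qed.

Lemma ones_from0 r m : ones_from r (r + m) 0 = row_mx 1%:M 0.
Proof.
apply/matrixP=> i j; rewrite mxE add0n; case: (split_ordP j) => {}j ->.
  by rewrite row_mxEl mxE eq_sym.
rewrite row_mxEr mxE /=; case: eqP => // e.
by have := ltn_ord i; rewrite -e ltnNge leq_addr.
Qed.

Lemma ones_from_id r : ones_from r r 0 = 1%:M.
Proof. by apply/matrixP=> i j; rewrite !mxE add0n eq_sym. Qed.

Lemma ebit_rowsE c m : ebit_rows c (c + m) = row_mx 1%:M (row_mx 1%:M 0).
Proof.
rewrite /ebit_rows ones_from0 -[X in ones_from _ _ X]addn0 ones_from_shift.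
by rewrite ones_from0 add_row_mx addr0 add0r.
Qed.

Lemma xcol_id N r (Z : 'M[F2rat]_(r, N)) i : xcol i i Z = Z.
Proof. by apply/matrixP=> u v; rewrite mxE tperm1 perm1. Qed.

(** * Encoding and decoding circuits *)

Lemma alice_columns_mulmx c n r s (U : 'M[F2rat]_(s, r))
    (W : 'M_(r, (c + n) + (c + n))) :
  alice_columns (U *m W) = U *m alice_columns W.
Proof. by rewrite /alice_columns mul_mx_row !(mulmx_lsub, mulmx_rsub). Qed.

Lemma run_add N r (W1 W2 : 'M[F2rat]_(r, N + N)) C :
  run C (W1 + W2) = run C W1 + run C W2.
Proof. by rewrite run_mulmxr mulmxDl -!run_mulmxr. Qed.

Lemma row_mx_col0 (R : nmodType) m1 m2 n1 n2 (A : 'M[R]_(m1, n1))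
    (B : 'M_(m1, n2)) :
  row_mx (col_mx A 0) (col_mx B 0) = col_mx (row_mx A B) (0 : 'M_(m2, _)).
Proof. by rewrite -block_mxEh block_mxEv row_mx0. Qed.

Lemma row_mx_0col (R : nmodType) m1 m2 n1 n2 (A : 'M[R]_(m2, n1))
    (B : 'M_(m2, n2)) :
  row_mx (col_mx 0 A) (col_mx 0 B) = col_mx (0 : 'M_(m1, _)) (row_mx A B).
Proof. by rewrite -block_mxEh block_mxEv row_mx0. Qed.

Lemma col_row_mx0 (R : nmodType) m1 m2 n1 n2 (A : 'M[R]_(m1, n2)) :
  col_mx (row_mx 0 A) 0 = row_mx (0 : 'M_(m1 + m2, n1)) (col_mx A 0).
Proof. by rewrite -row_mx_col0 col_mx0. Qed.

Lemma col_0row_mx (R : nmodType) m1 m2 n1 n2 (A : 'M[R]_(m2, n2)) :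
  col_mx 0 (row_mx 0 A) = row_mx (0 : 'M_(m1 + m2, n1)) (col_mx 0 A).
Proof. by rewrite -row_mx_0col col_mx0. Qed.

Lemma shifted_qubits_rshift k c n (q : 'I_k -> 'I_n) l :
  shifted_qubits (fun j => rshift c (q j)) l = row_mx 0 (shifted_qubits q l).
Proof.
apply/matrixP=> i j; rewrite mxE; case: (split_ordP j) => {}j ->.
  by rewrite eq_lrshift row_mxEl mxE.
by rewrite row_mxEr mxE (inj_eq (@rshift_inj _ _)).
Qed.

Lemma shifted_qubits_id k : shifted_qubits (@id 'I_k) (fun=> 0) = 1%:M.
Proof.
by apply/matrixP=> i j; rewrite !mxE expr0z eq_sym; case: eqP.
Qed.

Lemma laurent0 : laurent 0.
Proof. by exists 0, 0; rewrite rmorph0 mulr0. Qed.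

Lemma laurent_atD p : laurent (atD p).
Proof. by exists p, 0; rewrite expr0z mul1r. Qed.

(** The sizes are tied to the block sizes by equations, so that [n] can be replaced by a sum of
    blocks while [r1] and [r2] remain the differences of the theorem. *)
Lemma circuits_exist c a1 a2 k n r1 r2 (H1 : 'M[F2D]_(r1, n))
    (H2 : 'M[F2D]_(r2, n)) :
  n = (c + (a1 + a2 + k))%N -> r1 = (c + a1)%N -> r2 = (c + a2)%N -> (0 < c)%N ->
  \rank (map_mx atD H1) = r1 :> nat -> \rank (map_mx atD H2) = r2 :> nat ->
  \rank (map_mx atD H1 *m (map_mx atDinv H2)^T) = c :> nat ->
  exists enc dec : circuit (c + n),
    [/\ encoding_circuit k (check_matrix H1 H2) enc,
        has (fun o => ~~ finite_depth o) enc,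
        has (@finite_depth (c + n)) enc,
        decoding_circuit k enc dec
      & all (@finite_depth (c + n)) dec].
Proof.
move=> en e1 e2 c0 rH1 rH2 rE; subst n.
have conjH2 : map_mx conjD (map_mx atD H2) = map_mx atDinv H2.
  by apply/matrixP=> i j; rewrite !mxE conjD_atD.
have [|||W' [W [cW [F [zc [z1 [xc [x2 [ZW XW]]]]]]]]] :=
    @normal_form c a1 a2 k r1 r2 (map_mx atD H1) (map_mx atD H2).
- by rewrite rH1.
- by rewrite rH2.
- by rewrite conjH2.
have [C [iC rC _ _]] := cW.
have [d [w [d0 Fw]]] := common_denominator (fun ij => F ij.1 ij.2).
pose G : 'M[{poly 'F_2}]_(c, k) := \matrix_(i, j) w (i, j).
have FG : F = (atDinv d)^-1 *: map_mx atDinv G.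
  by apply/matrixP=> i j; rewrite !mxE -(Fw (i, j)).
have [E [hE rE']] := encoder_rows a1 a2 G d0.
(* These CNOTs run from the information qubits to Bob's qubits; the zero blocks leave out Alice's
   ebit halves and the ancillas. *)
have [B iB rB] := block_CNOTs (row_mx 0 (row_mx 0 G) : 'M_(c, c + (a1 + a2 + k))).
pose i0 : 'I_(c + (a1 + a2 + k)) := lshift _ (Ordinal c0).
pose up := map (@alice_op c (c + (a1 + a2 + k))).
(* The trivial SWAP ensures that a finite-depth operation occurs. *)
exists (up (Swap i0 i0 :: E ++ rev C)), (up C ++ B).
rewrite /encoding_circuit /decoding_circuit /unencoded_stabilizer
  /unencoded_information.
have -> : (c + (a1 + a2 + k) - k - c)%N = (a1 + a2)%N by lia.
rewrite !ebit_rowsE.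
have -> : ones_from (a1 + a2) (c + (c + (a1 + a2 + k))) (c + c) =
          row_mx 0 (row_mx 0 (row_mx 1%:M 0)).
  by rewrite ones_from_shift -[X in ones_from _ _ X]addn0 ones_from_shift ones_from0.
have -> : ones_from k (c + (c + (a1 + a2 + k))) (c + c + (a1 + a2)) =
          row_mx 0 (row_mx 0 (row_mx 0 1%:M)).
  rewrite -(addnA c c) !ones_from_shift -[X in ones_from _ _ X]addn0 ones_from_shift.
  by rewrite ones_from_id.
set S := row_mx (col_mx (col_mx _ _) _) _; set P := row_mx 0 (row_mx 0 _).
(* General combination of stabilizer generators: [al] and [ga] weight the Z- and X-rows of the
   ebits, [be] the ancilla rows. *)
have US r (al ga : 'M_(r, c)) (be : 'M_(r, a1 + a2)) :
    row_mx (row_mx al ga) be *m S =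
    row_mx (row_mx al (row_mx al (row_mx be 0))) (row_mx ga (row_mx ga 0)).
  rewrite /S mul_mx_row !mul_row_col !mulmx0 !add0r !addr0 !mul_mx_row.
  by rewrite !mulmx1 !mulmx0 !add_row_mx !addr0 !add0r.
split.
- split.
    rewrite /up all_map (@eq_all _ _ predT) ?all_predT // => o.
    exact: alice_op_within.
  (* Coefficients read off the normal form; the factors 1/d(1/D) and d(D) compensate for the
     infinite-depth scaling of the ebits in Z and in X. *)
  pose al := col_mx ((atDinv d)^-1 *: zc) (0 : 'M_(r2, c)).
  pose ga := col_mx (0 : 'M_(r1, c)) (atD d *: xc).
  pose be := row_mx (col_mx z1 (0 : 'M_(r2, a1))) (col_mx (0 : 'M_(r1, a2)) x2).
  apply: (@row_equivalent_mulmx _ _ _ _ _ (row_mx (row_mx al ga) be)).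
  + by rewrite e1 e2; lia.
  + by rewrite /row_free rank_diag_block_mx rH1 rH2.
  (* The check matrix is written as [rev C] applied to its normal form, which cancels the final
     [rev C] of the encoder. *)
  rewrite alice_columns_run run_cons -[LHS](run_Krev _ iC) run_cat.
  rewrite -run_mulmx; congr run; rewrite -run_mulmx.
  have -> : apply_op (alice_columns S) (Swap i0 i0) = alice_columns S.
    by rewrite /= !xcol_id hsubmxK.
  rewrite -alice_columns_mulmx US /alice_columns !(row_mxKl, row_mxKr).
  rewrite /be -[0 as X in row_mx ga X]row_mx0 rE' /check_matrix block_mxEh rC.
  rewrite !mul_col_mx !mul0mx ZW XW.
  have -> : atDinv d *: al = col_mx zc 0.
    by rewrite scale_col_mx scaler0 scalerA mulfV ?atDinv_eq0 // scale1r.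
  have -> : (atD d)^-1 *: (ga + 0) = col_mx 0 xc.
    by rewrite addr0 scale_col_mx scaler0 scalerA mulVf ?atD_eq0 // scale1r.
  rewrite add0r -scalemxAl scalemxAr -FG -[X in row_mx (col_mx z1 0) X]col_mx0.
  rewrite -[X in row_mx X (col_mx 0 x2)]col_mx0.
  rewrite -[X in row_mx (row_mx _ (col_mx 0 x2)) X]col_mx0.
  by rewrite !(row_mx_col0, row_mx_0col).
- rewrite /up has_map (eq_has (a2 := fun o => ~~ finite_depth o)).
    by rewrite /= has_cat hE.
  by move=> o; rewrite /= finite_depth_alice_op.
- by [].
- pose ga := col_mx (0 : 'M_(k, c)) (map_mx atD G)^T.
  exists (fun j => rshift c (rshift c (rshift (a1 + a2) j))), (fun=> 0).
  exists (row_mx (row_mx 0 ga) 0); split.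
  + by move=> i j /rshift_inj/rshift_inj/rshift_inj.
  + move=> i j; case: (split_ordP j) => {}j ->; last first.
      by rewrite row_mxEr mxE; apply: laurent0.
    rewrite row_mxEl; case: (split_ordP j) => {}j ->.
      by rewrite row_mxEl mxE; apply: laurent0.
    rewrite row_mxEr; case: (split_ordP i) => {}i ->.
      by rewrite col_mxEu mxE; apply: laurent0.
    by rewrite col_mxEd !mxE; apply: laurent_atD.
  rewrite -!run_mulmx -!run_add US /P block_mxEh.
  pose ze := col_mx (1%:M : 'M[F2rat]_k) (0 : 'M_k).
  pose xi := col_mx (0 : 'M[F2rat]_k) (1%:M : 'M_k).
  have xiG : xi *m (map_mx atD G)^T = ga by rewrite mul_col_mx mul0mx mul1mx.
  rewrite !col_row_mx0 !col_0row_mx -/ze -/xi.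
  rewrite add_row_mx !add_row_mx !addr0 !add0r.
  rewrite run_alice_op run_cons.
  have -> : apply_op (row_mx (row_mx 0 (row_mx 0 ze)) (row_mx ga (row_mx 0 xi)))
     (Swap i0 i0) = row_mx (row_mx 0 (row_mx 0 ze)) (row_mx ga (row_mx 0 xi)).
    by rewrite /= !row_mxKl !row_mxKr !xcol_id.
  rewrite [run (E ++ rev C) _]run_cat [LHS]run_cat run_alice_op hsubmxK run_revK //.
  rewrite -[0 as X in row_mx (row_mx 0 (row_mx X ze)) _]row_mx0 rE'.
  rewrite !row_mxKl !row_mxKr scaler0 mul0mx addr0 xiG mx_add_self scaler0.
  rewrite !row_mx0 rB mul0mx addr0 !map_row_mx !map_mx0 !tr_row_mx !trmx0.
  rewrite !mul_row_col !mul0mx !add0r xiG mx_add_self.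
  have -> : shifted_qubits (fun j : 'I_k => rshift c (rshift c (rshift (a1 + a2) j)))
      (fun=> 0) = row_mx 0 (row_mx 0 (row_mx 0 1%:M)).
    by rewrite 3!shifted_qubits_rshift shifted_qubits_id.
  by rewrite block_mxEh !col_row_mx0 !col_0row_mx.
rewrite all_cat; apply/andP; split.
  rewrite /up all_map; apply: sub_all iC => o /=.
  by rewrite finite_depth_alice_op; apply: involutive_finite_depth.
by apply: sub_all iB => o; apply: involutive_finite_depth.
Qed.

(** * Ranks of the check matrices, and the theorem *)

Lemma map_mx_unit (R : comUnitRingType) (F : fieldType) (f : {rmorphism R -> F})
    m (A : 'M[R]_m) : A \in unitmx -> map_mx f A \in unitmx.
Proof. by rewrite !unitmxE det_map_mx; apply: rmorph_unit. Qed.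

Lemma pid_mx_first_rows n k (B : 'M[F2D]_n) :
  pid_mx (n - k) *m B = first_rows k B.
Proof.
apply/matrixP=> i j; rewrite !mxE (bigD1 (widen_ord (leq_subr k n) i)) //=.
rewrite mxE /= eqxx ltn_ord mul1r big1 ?addr0 // => l li.
rewrite mxE (_ : (i == l :> nat) = false) ?mul0r //.
by apply: contraNF li => /eqP e; apply/eqP/val_inj.
Qed.

Lemma mxrank_check n k (H : 'M[F2D]_(n - k, n)) A B :
  smith_decomposition H A B -> \rank (map_mx atD H) = (n - k)%N :> nat.
Proof.
case=> uA uB ->; rewrite !map_mxM map_pid_mx mxrankMfree; last first.
  by rewrite row_free_unit map_mx_unit.
rewrite eqmxMfull ?row_full_unit ?map_mx_unit //.
by rewrite rank_pid_mx // leq_subr.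
Qed.

(** The two products differ only by [A1] on the left and the conjugate transpose of [A2] on the
    right, both invertible over F_2(D). *)
Lemma mxrank_Emx n k1 k2 (H1 : 'M[F2D]_(n - k1, n)) (H2 : 'M[F2D]_(n - k2, n))
    A1 A2 B1 B2 :
  smith_decomposition H1 A1 B1 -> smith_decomposition H2 A2 B2 ->
  \rank (map_mx atD H1 *m (map_mx atDinv H2)^T) = \rank (Emx k1 k2 B1 B2).
Proof.
case=> uA1 _ -> [uA2 _ ->].
rewrite -!mulmxA !pid_mx_first_rows !map_mxM trmx_mul -mulmxA mulmxA.
rewrite mulmxA mxrankMfree; last first.
  by rewrite row_free_unit unitmx_tr map_mx_unit.
by rewrite -mulmxA eqmxMfull // row_full_unit map_mx_unit.
Qed.

(** Serves to exclude [c = 0] in the theorem. *)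
Lemma smith_form0 m n : smith_form (0 : 'M[F2rat]_(m, n)) 0.
Proof.
have l1 q : laurent_unitmx (1%:M : 'M[F2rat]_q).
  split; rewrite ?unitmx1 ?invmx1 // => i j; rewrite mxE;
    by case: eqP => _; [rewrite -(rmorph1 atD); apply: laurent_atD | apply: laurent0].
split=> [i j|i j _|i i' j j' _ _ _|]; rewrite ?mxE //; first exact: laurent0.
  by exists 0; [apply: laurent0 | rewrite mul0r].
by exists 1%:M, 1%:M; split; rewrite ?mulmx0 ?mul0mx.
Qed.

Theorem lemma3 (n k1 k2 c : nat) (hk1 : (k1 <= n)%N) (hk2 : (k2 <= n)%N)
    (H1 : 'M[F2D]_(n - k1, n)) (H2 : 'M[F2D]_(n - k2, n))
    (A1 : 'M[F2D]_(n - k1)) (A2 : 'M[F2D]_(n - k2)) (B1 B2 : 'M[F2D]_n)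
    (hH1 : smith_decomposition H1 A1 B1) (hH2 : smith_decomposition H2 A2 B2)
    (hc : \rank (Emx k1 k2 B1 B2) = c)
    (hE : forall S : 'M[F2rat]_(n - k1, n - k2),
        smith_form (Emx k1 k2 B1 B2) S -> ~ monomial_block c S) :
  exists enc dec : circuit (c + n),
    [/\ encoding_circuit (k1 + k2 + c - n) (check_matrix H1 H2) enc,
        has (fun o => ~~ finite_depth o) enc,
        has (@finite_depth (c + n)) enc,
        decoding_circuit (k1 + k2 + c - n) enc dec
      & all (@finite_depth (c + n)) dec].
Proof.
(* If [c = 0], then [E] is zero and is its own Smith form, of the excluded shape with an empty
   Gamma. So there is an ebit for the infinite-depth operation to act on. *)
have c0 : (0 < c)%N.
  rewrite lt0n; apply/eqP=> c0; move: hc; rewrite c0 => /eqP.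
  rewrite mxrank_eq0 => /eqP E0; apply: (hE 0).
    by rewrite E0; apply: smith_form0.
  by exists (fun=> 0); apply/matrixP=> i j; rewrite !mxE c0 ltn0 andbF.
have [r1 r2] := (mxrank_check hH1, mxrank_check hH2).
have r2' : \rank (map_mx atDinv H2)^T = (n - k2)%N.
  have -> : map_mx atDinv H2 = map_mx conjD (map_mx atD H2).
    by apply/matrixP=> i j; rewrite !mxE conjD_atD.
  by rewrite mxrank_tr mxrank_map.
have rE := mxrank_Emx hH1 hH2; rewrite hc in rE.
(* Sylvester's inequality gives n <= k1 + k2 + c, and the two upper bounds on the rank give c <= n -
   k1 and c <= n - k2; hence no subtraction in the block sizes is truncated. *)
have := mxrank_mul_min (map_mx atD H1) (map_mx atDinv H2)^T.
have := mxrankM_maxl (map_mx atD H1) (map_mx atDinv H2)^T.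
have := mxrankM_maxr (map_mx atD H1) (map_mx atDinv H2)^T.
rewrite rE r1 r2' => le2 le1 le3.
apply: (@circuits_exist c (n - k1 - c) (n - k2 - c)) => //; lia.
Qed.
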